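(* Let $N\ge 0$ be an integer, let $\{\tilde\Phi_\ell\}_{\ell\ge 0}$ be the normalized orthogonal polynomials with respect to the weight function $w$ on $[-1,1]$, let $x_0,\dots,x_N$ be the zeros of $\tilde\Phi_{N+1}$ and $\omega_0,\dots,\omega_N$ the corresponding Gauss quadrature weights. Let $f\in\mathcal C([-1,1])$, $\lambda>0$ and $0\le\mu_0\le\mu_1\le\dots\le\mu_N$. Then, for $L=N$, the $\ell_1$-regularized approximation polynomial $p^{\ell_1}_{N,N+1}$ has, for $x\in[-1,1]\setminus\{x_0,\dots,x_N\}$, the barycentric form $$p^{\ell_1}_{N,N+1}(x)=\frac{\displaystyle\sum_{j=0}^N\frac{\Omega_j}{x-x_j}\Bigl(f(x_j)+\sum_{\ell=0}^Nc_\ell\tilde\Phi_\ell(x_j)\Bigr)}{\displaystyle\sum_{j=0}^N\frac{\Omega_j}{x-x_j}},$$ where $\Omega_j=\omega_j\tilde\Phi_N(x_j)$ and $c_\ell=\tfrac12S_{\lambda\mu_\ell}(2\alpha_\ell)-\alpha_\ell$ with $\alpha_\ell=\sum_{j=0}^N\omega_j\tilde\Phi_\ell(x_j)f(x_j)$, $\ell=0,1,\dots,N$.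
   Context: The weight function $w:(-1,1)\to\mathbb R$ is positive with $\int_{-1}^1 w(x)\,dx<\infty$ and $\int_{-1}^1x^iw(x)\,dx<\infty$ for $i=1,2,\dots$. $\tilde\Phi_\ell$ is a polynomial of degree $\ell$, and $\int_{-1}^1w(x)\tilde\Phi_\ell(x)\tilde\Phi_{\ell'}(x)\,dx=\delta_{\ell,\ell'}$. The Gauss quadrature weights $\omega_j>0$ are those for which $\sum_{j=0}^N\omega_jp(x_j)=\int_{-1}^1w(x)p(x)\,dx$ for all polynomials $p$ of degree at most $2N+1$. The soft threshold operator is $S_k(a)=\max(0,a-k)+\min(0,a+k)$. The $\ell_1$-regularized approximation polynomial (with $L=N$) is $$p^{\ell_1}_{N,N+1}(x)=\frac12\sum_{\ell=0}^{N}S_{\lambda\mu_\ell}(2\alpha_\ell)\,\tilde\Phi_\ell(x).$$ *)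

(* Defs.v *)
From HB Require Import structures.
From mathcomp Require Import all_boot all_order all_algebra.
From mathcomp Require Import all_classical all_reals all_analysis.

Set Implicit Arguments.
Unset Strict Implicit.
Unset Printing Implicit Defensive.

Import Order.TTheory GRing.Theory Num.Theory.
Import numFieldNormedType.Exports.

Local Open Scope classical_set_scope.
Local Open Scope ring_scope.

(* The values of [w] outside the open interval (-1, 1) are irrelevant.
   Integrability includes measurability; the case [i = 0] is the finiteness
   of the total mass. *)
Definition weight_function (R : realType) (w : R -> R) : Prop :=
  (forall x : R, -1 < x < 1 -> 0 < w x) /\
  (forall i : nat,
     (@lebesgue_measure R).-integrable `](-1), 1[
       (fun x : R => (x ^+ i * w x)%:E)).

Definition wint (R : realType) (w : R -> R) (p : {poly R}) : R :=
  \int[@lebesgue_measure R]_(x in `](-1), 1[) (w x * p.[x]).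

(* No sign is imposed on the leading coefficients. *)
Definition normalized_orthogonal (R : realType) (w : R -> R)
    (Phi : nat -> {poly R}) : Prop :=
  (forall l : nat, size (Phi l) = l.+1) /\
  (forall l l' : nat, wint w (Phi l * Phi l') = (l == l')%:R).

Definition gauss_weights (R : realType) (w : R -> R) (N : nat)
    (x omega : 'I_N.+1 -> R) : Prop :=
  (forall j, 0 < omega j) /\
  (forall p : {poly R}, (size p <= (2 * N + 1).+1)%N ->
     \sum_(j < N.+1) omega j * p.[x j] = wint w p).

Definition soft_threshold (R : realType) (k a : R) : R :=
  Num.max 0 (a - k) + Num.min 0 (a + k).

Definition alpha (R : realType) (Phi : nat -> {poly R}) (N : nat)
    (x omega : 'I_N.+1 -> R) (f : R -> R) (l : nat) : R :=
  \sum_(j < N.+1) omega j * (Phi l).[x j] * f (x j).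

Definition l1_poly (R : realType) (Phi : nat -> {poly R}) (N : nat)
    (x omega : 'I_N.+1 -> R) (f : R -> R) (lambda : R) (mu : 'I_N.+1 -> R)
    : {poly R} :=
  2^-1 *: \sum_(l < N.+1)
    soft_threshold (lambda * mu l) (2 * alpha Phi x omega f l) *: Phi l.

Definition bary_weight (R : realType) (Phi : nat -> {poly R}) (N : nat)
    (x omega : 'I_N.+1 -> R) (j : 'I_N.+1) : R :=
  omega j * (Phi N).[x j].

Definition l1_correction (R : realType) (Phi : nat -> {poly R}) (N : nat)
    (x omega : 'I_N.+1 -> R) (f : R -> R) (lambda : R) (mu : 'I_N.+1 -> R)
    (l : 'I_N.+1) : R :=
  2^-1 * soft_threshold (lambda * mu l) (2 * alpha Phi x omega f l)
  - alpha Phi x omega f l.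

(* Main.v *)
Require Import Defs.
From HB Require Import structures.
From mathcomp Require Import all_boot all_order all_algebra.
From mathcomp Require Import all_classical all_reals all_analysis.
From mathcomp Require Import zify ring.

Set Implicit Arguments.
Unset Strict Implicit.
Unset Printing Implicit Defensive.

Import Order.TTheory GRing.Theory Num.Theory.
Import numFieldNormedType.Exports.

Local Open Scope classical_set_scope.
Local Open Scope ring_scope.

(** Gauss quadrature is exact on the products [Phi_l * Phi_l'] with
    [l, l' <= N], so [Phi_0, ..., Phi_N] are orthonormal for the discrete inner
    product [<p, q> = \sum_j omega_j p(x_j) q(x_j)]; from there on no integral
    is involved.  Three facts about this inner product give the theorem.

    The square matrix with entries [Phi_l(x_j)] has orthonormal rows for the
    weights [omega_j], hence dually orthonormal columns.  Therefore
    [\sum_l alpha_l Phi_l] interpolates [f] at the nodes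
    ([alpha_interpolates]), and the value at [x_j] of the regularized
    polynomial [P = \sum_l (alpha_l + c_l) Phi_l] is
    [f(x_j) + \sum_l c_l Phi_l(x_j)].

    Pairing a polynomial [q] of degree at most [N] with [Phi_N] reads off its
    coefficient of degree [N] ([gauss_top_coef]), since [q] is a combination of
    [Phi_0, ..., Phi_N] and only the last of them reaches that degree.

    Applying this to the quotient of [p(t) Phi_{N+1} - Phi_{N+1}(t) p] by
    [X - t] gives, for every [p] of degree at most [N],
    [Phi_{N+1}(t) \sum_j Omega_j p(x_j) / (t - x_j) = p(t) k_{N+1} / k_N],
    where [k_n] is the leading coefficient of [Phi_n] ([bary_sum]).  The case
    [p = 1] shows that the barycentric denominator is nonzero, and the quotient
    of the cases [p = P] and [p = 1] is the claimed formula. *)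

(** A family with one polynomial in each degree is triangular with respect to
    the monomials: the top coefficient is removed by a multiple of the last
    member, and one recurses. *)
Lemma graded_poly_span (F : fieldType) (Phi : nat -> {poly F})
    (sizePhi : forall l, size (Phi l) = l.+1) (n : nat) (q : {poly F}) :
  (size q <= n)%N ->
  exists a : nat -> F, q = \sum_(l < n) a l *: Phi l.
Proof.
elim: n q => [|n IHn] q sq.
  exists (fun=> 0); rewrite big_ord0.
  by apply/eqP; rewrite -size_poly_leq0.
have k_neq0 : (Phi n)`_n != 0.
  have -> : (Phi n)`_n = lead_coef (Phi n) by rewrite lead_coefE sizePhi.
  by rewrite lead_coef_eq0 -size_poly_eq0 sizePhi.
pose b := q`_n / (Phi n)`_n.
have [|a qE] := IHn (q - b *: Phi n).
  apply/leq_sizeP => j; rewrite leq_eqVlt => /predU1P[<-|ltnj].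
    by rewrite coefB coefZ divfK// subrr.
  rewrite coefB coefZ !nth_default ?mulr0 ?subrr ?sizePhi//.
  exact: leq_trans ltnj.
exists (fun l => if l == n then b else a l).
rewrite big_ord_recr/= eqxx -[LHS](subrK (b *: Phi n)) qE; congr (_ + _).
by apply: eq_bigr => i _; rewrite (ltn_eqF (ltn_ord i)).
Qed.

(** The product of two polynomials of degree at most [N] lies within the range
    of exactness of the quadrature. *)
Lemma gauss_orthonormal (R : realType) (w : R -> R) (Phi : nat -> {poly R})
    (N : nat) (x omega : 'I_N.+1 -> R) :
  normalized_orthogonal w Phi -> gauss_weights w x omega ->
  forall l l' : 'I_N.+1,
    \sum_(j < N.+1) omega j * ((Phi l).[x j] * (Phi l').[x j])
      = (l == l')%:R.
Proof.
move=> [sizePhi orthoPhi] [_ exact_omega] l l'.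
rewrite -(orthoPhi l l') -exact_omega; last first.
  apply: leq_trans (size_polyMleq _ _) _; rewrite !sizePhi.
  by have := ltn_ord l; have := ltn_ord l'; lia.
by apply: eq_bigr => j _; rewrite hornerM.
Qed.

(** A right inverse of a square matrix is a left inverse: with
    [A = (Phi_l(x_j))] and [D = diag(omega)], orthonormality is
    [A * (D * A^T) = 1], hence [(D * A^T) * A = 1]. *)
Lemma gauss_dual_orthonormal (R : realType) (w : R -> R)
    (Phi : nat -> {poly R}) (N : nat) (x omega : 'I_N.+1 -> R) :
  normalized_orthogonal w Phi -> gauss_weights w x omega ->
  forall i j : 'I_N.+1,
    \sum_(l < N.+1) omega i * (Phi l).[x i] * (Phi l).[x j] = (i == j)%:R.
Proof.
move=> hPhi homega i j.
pose A : 'M[R]_N.+1 := \matrix_(l, k) (Phi l).[x k].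
pose B : 'M[R]_N.+1 := \matrix_(k, l) (omega k * (Phi l).[x k]).
have AB1 : A *m B = 1%:M.
  apply/matrixP => l l'.
  rewrite !mxE -(gauss_orthonormal hPhi homega).
  by apply: eq_bigr => k _; rewrite !mxE mulrCA.
have /matrixP/(_ i j) := mulmx1C AB1; rewrite !mxE => <-.
by apply: eq_bigr => l _; rewrite !mxE.
Qed.

Lemma alpha_interpolates (R : realType) (w : R -> R) (Phi : nat -> {poly R})
    (N : nat) (x omega : 'I_N.+1 -> R) (f : R -> R) :
  normalized_orthogonal w Phi -> gauss_weights w x omega ->
  forall j : 'I_N.+1,
    \sum_(l < N.+1) alpha Phi x omega f l * (Phi l).[x j] = f (x j).
Proof.
move=> hPhi homega j.
under eq_bigr do rewrite mulr_suml.
rewrite exchange_big/= (bigD1 j)//= [X in _ + X]big1 ?addr0.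
  transitivity ((\sum_(l < N.+1) omega j * (Phi l).[x j] * (Phi l).[x j])
                  * f (x j)).
    by rewrite mulr_suml; apply: eq_bigr => l _; rewrite mulrAC.
  by rewrite (gauss_dual_orthonormal hPhi homega) eqxx mul1r.
move=> i /negPf i_neq_j.
transitivity ((\sum_(l < N.+1) omega i * (Phi l).[x i] * (Phi l).[x j])
                * f (x i)).
  by rewrite mulr_suml; apply: eq_bigr => l _; rewrite mulrAC.
by rewrite (gauss_dual_orthonormal hPhi homega) i_neq_j mul0r.
Qed.

(** In the expansion [q = \sum_l a_l Phi_l] both sides equal [a_N k_N]: the
    pairing with [Phi_N] isolates [a_N], and the lower [Phi_l] have no
    coefficient of degree [N]. *)
Lemma gauss_top_coef (R : realType) (w : R -> R) (Phi : nat -> {poly R})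
    (N : nat) (x omega : 'I_N.+1 -> R) (q : {poly R}) :
  normalized_orthogonal w Phi -> gauss_weights w x omega ->
  (size q <= N.+1)%N ->
  (\sum_(j < N.+1) bary_weight Phi x omega j * q.[x j]) * lead_coef (Phi N)
    = q`_N.
Proof.
move=> hPhi homega sq; have [sizePhi _] := hPhi.
have [a qE] := graded_poly_span sizePhi sq.
have -> : \sum_(j < N.+1) bary_weight Phi x omega j * q.[x j] = a N.
  transitivity (\sum_(l < N.+1) a l *
      \sum_(j < N.+1) omega j * ((Phi (@ord_max N)).[x j] * (Phi l).[x j])).
    under [RHS]eq_bigr do rewrite mulr_sumr.
    rewrite [RHS]exchange_big/=; apply: eq_bigr => j _.
    rewrite qE horner_sum mulr_sumr; apply: eq_bigr => l _.
    by rewrite hornerZ /bary_weight; ring.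
  under eq_bigr do rewrite (gauss_orthonormal hPhi homega).
  rewrite (bigD1 ord_max)//= eqxx mulr1 big1 ?addr0// => l.
  by rewrite eq_sym => /negPf ->; rewrite mulr0.
rewrite qE coef_sum big_ord_recr/= big1 ?add0r => [|l _].
  by rewrite coefZ lead_coefE sizePhi.
by rewrite coefZ nth_default ?mulr0// sizePhi.
Qed.

(** The polynomial [p(t) Phi_{N+1} - Phi_{N+1}(t) p] vanishes at [t]; its
    quotient [g] by [X - t] has degree at most [N] with coefficient
    [p(t) k_{N+1}] there, and [g(x_j) = Phi_{N+1}(t) p(x_j) / (t - x_j)] because
    the nodes are zeros of [Phi_{N+1}]. *)
Lemma bary_sum (R : realType) (w : R -> R) (Phi : nat -> {poly R})
    (N : nat) (x omega : 'I_N.+1 -> R) (p : {poly R}) (t : R) :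
  normalized_orthogonal w Phi -> gauss_weights w x omega ->
  (forall j, root (Phi N.+1) (x j)) -> (forall j, t <> x j) ->
  (size p <= N.+1)%N ->
  (Phi N.+1).[t] * (\sum_(j < N.+1)
      bary_weight Phi x omega j / (t - x j) * p.[x j])
    = p.[t] * (lead_coef (Phi N.+1) / lead_coef (Phi N)).
Proof.
move=> hPhi homega xroot t_neq sp; have [sizePhi _] := hPhi.
pose h := p.[t] *: Phi N.+1 - (Phi N.+1).[t] *: p.
have /factor_theorem[g hE] : root h t.
  by rewrite rootE /h hornerD hornerN !hornerZ mulrC subrr.
have sh : (size h <= N.+2)%N.
  apply: leq_trans (size_polyD _ _) _; rewrite geq_max size_polyN.
  rewrite (leq_trans (size_scale_leq _ _)) ?sizePhi//.
  by rewrite (leq_trans (size_scale_leq _ _)) ?(leq_trans sp).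
have sg : (size g <= N.+1)%N.
  have [->|g0] := eqVneq g 0; first by rewrite size_poly0.
  by move: sh; rewrite hE size_Mmonic ?monicXsubC// size_XsubC addn2.
have gN : g`_N = p.[t] * lead_coef (Phi N.+1).
  have : h`_N.+1 = g`_N.
    by rewrite hE mulrBr coefB coefMX coefMC/= (nth_default _ sg) mul0r subr0.
  rewrite /h coefB !coefZ (nth_default _ sp) mulr0 subr0 => <-.
  by rewrite lead_coefE sizePhi.
have g_node j : g.[x j] = (Phi N.+1).[t] * p.[x j] / (t - x j).
  have tx : t - x j != 0 by rewrite subr_eq0; apply/eqP.
  apply: (mulIf tx); rewrite divfK//; apply: oppr_inj.
  have := congr1 (horner^~ (x j)) hE.
  rewrite hornerM hornerXsubC /h hornerD hornerN !hornerZ.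
  by rewrite (rootP (xroot j)) mulr0 sub0r => ->; ring.
have k_neq0 : lead_coef (Phi N) != 0.
  by rewrite lead_coef_eq0 -size_poly_eq0 sizePhi.
rewrite mulrA -gN -(gauss_top_coef hPhi homega sg) mulfK// mulr_sumr.
by apply: eq_bigr => j _; rewrite g_node; ring.
Qed.

Theorem mainTheorem4 (R : realType) (w : R -> R) (Phi : nat -> {poly R})
    (N : nat) (x omega : 'I_N.+1 -> R) (f : R -> R) (lambda : R)
    (mu : 'I_N.+1 -> R)
    (hw : weight_function w)
    (hPhi : normalized_orthogonal w Phi)
    (hx : forall t : R, root (Phi N.+1) t <-> exists j : 'I_N.+1, t = x j)
    (homega : gauss_weights w x omega)
    (hf : {within `[(-1 : R), 1], continuous f})
    (hlambda : 0 < lambda)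
    (hmu0 : forall l : 'I_N.+1, 0 <= mu l)
    (hmu : forall l l' : 'I_N.+1, (l <= l')%N -> mu l <= mu l') :
  let Omega := bary_weight Phi x omega in
  let c := l1_correction Phi x omega f lambda mu in
  forall t : R, -1 <= t <= 1 -> (forall j : 'I_N.+1, t <> x j) ->
    \sum_(j < N.+1) Omega j / (t - x j) <> 0 /\
    (l1_poly Phi x omega f lambda mu).[t] =
      (\sum_(j < N.+1) Omega j / (t - x j) *
         (f (x j) + \sum_(l < N.+1) c l * (Phi l).[x j]))
      / (\sum_(j < N.+1) Omega j / (t - x j)).
Proof.
move=> Omega c t _ t_neq.
have [sizePhi _] := hPhi.
have xroot j : root (Phi N.+1) (x j) by apply/hx; exists j.
have Phit_neq0 : (Phi N.+1).[t] != 0.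
  by apply/negP => /hx[j]; exact: t_neq.
pose K := lead_coef (Phi N.+1) / lead_coef (Phi N).
have K_neq0 : K != 0.
  by rewrite mulf_neq0 ?invr_eq0// lead_coef_eq0 -size_poly_eq0 sizePhi.
have sumE (p : {poly R}) : (size p <= N.+1)%N ->
    \sum_(j < N.+1) Omega j / (t - x j) * p.[x j]
      = p.[t] * (K / (Phi N.+1).[t]).
  move=> sp; apply: (mulfI Phit_neq0).
  by rewrite (bary_sum hPhi homega xroot t_neq sp) -/K; field.
have denE : \sum_(j < N.+1) Omega j / (t - x j) = K / (Phi N.+1).[t].
  rewrite -[RHS]mul1r -(hornerC 1 t) -sumE ?size_poly1//.
  by apply: eq_bigr => j _; rewrite hornerC mulr1.
have den_neq0 : K / (Phi N.+1).[t] != 0 by rewrite mulf_neq0 ?invr_eq0.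
rewrite denE; split; first exact/eqP.
set P := l1_poly _ _ _ _ _ _.
have sP : (size P <= N.+1)%N.
  apply: leq_trans (size_scale_leq _ _) _.
  apply: leq_trans (size_sum _ _ _) _; apply/bigmax_leqP => l _.
  by rewrite (leq_trans (size_scale_leq _ _))// sizePhi.
have P_node j : P.[x j] = f (x j) + \sum_(l < N.+1) c l * (Phi l).[x j].
  rewrite -(alpha_interpolates f hPhi homega j) -big_split/=.
  rewrite hornerZ horner_sum mulr_sumr; apply: eq_bigr => l _.
  by rewrite hornerZ /c /l1_correction; ring.
under eq_bigr do rewrite -P_node.
by rewrite sumE// mulfK.
Qed.
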